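(* Let $\Omega\subsetneq\mathbb{C}$ be open and simply connected, let $F:\mathbb{D}\to\Omega$ be a biholomorphism, and let $a\in\Omega$. The geodesic-preserving functions for the family $\mathfrak{G}^{\Omega}_a$, i.e. the elements $f$ of $GP(\mathfrak{G}^{\Omega}_a,\mathfrak{G}^{\Omega}_a)$, are precisely the functions $$f=F\circ g\circ F^{-1},\qquad g\in GP(\mathfrak{G}^{\mathbb{D}}_{F^{-1}(a)},\mathfrak{G}^{\mathbb{D}}_{F^{-1}(a)}).$$
   Context: $\mathbb{D}$ is the open unit disc. The Kobayashi metric on $\Omega$ is $k_\Omega(z,w)=k_{\mathbb{D}}(F^{-1}(z),F^{-1}(w))$, where $k_{\mathbb{D}}$ is the Poincaré metric. A geodesic in a domain is a curve that is length-minimizing for the Kobayashi metric between any two of its points; in $\mathbb{D}$, a geodesic line is a geodesic defined on all of $\mathbb{R}$ whose limits at $\pm\infty$ lie on $\partial\mathbb{D}$, and the geodesic lines of $\Omega$ are the images under $F$ of the geodesic lines of $\mathbb{D}$. Geodesics are identified with their images. For a point $a$ in the closure of the domain $\Omega$ (or $\mathbb{D}$), $\mathfrak{G}^{\Omega}_a$ (or $\mathfrak{G}^{\mathbb{D}}_a$) is the family of all images $\gamma$ of geodesic lines in the domain with $a\in\overline{\gamma}$. Given families $\mathfrak{F}_1,\mathfrak{F}_2$ of geodesics in domains $\Omega_1,\Omega_2$, $GP(\mathfrak{F}_1,\mathfrak{F}_2)$ is the set of holomorphic maps $f:\Omega_1\to\Omega_2$ such that for every $\gamma_1\in\mathfrak{F}_1$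 there is $\gamma_2\in\mathfrak{F}_2$ with $f(\gamma_1)\subset\gamma_2$. *)

(* Defs.v *)
From Stdlib Require Export Reals.
From Coquelicot Require Export Coquelicot.
Open Scope R_scope.

(* A map from a subset U of C is represented by a total function C -> C of
   which only the values on U are meaningful. *)

Definition holomorphic_on (U : C -> Prop) (f : C -> C) : Prop :=
  forall z, U z -> ex_derive (K := C_AbsRing) (V := C_NormedModule) f z.

Definition maps_into (U V : C -> Prop) (f : C -> C) : Prop :=
  forall z, U z -> V (f z).

Definition biholomorphism (U V : C -> Prop) (F Finv : C -> C) : Prop :=
  maps_into U V F /\ maps_into V U Finv /\
  (forall z, U z -> Finv (F z) = z) /\
  (forall w, V w -> F (Finv w) = w) /\
  holomorphic_on U F /\ holomorphic_on V Finv.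

Definition unit_disc (z : C) : Prop := Cmod z < 1.

Definition closure (S : C -> Prop) (z : C) : Prop :=
  forall P : C -> Prop, locally z P -> exists w, P w /\ S w.

Definition unit_interval (t : R) : Prop := 0 <= t <= 1.

Definition unit_square (p : R * R) : Prop :=
  unit_interval (fst p) /\ unit_interval (snd p).

Definition curve_in (U : C -> Prop) (I : R -> Prop) (gamma : R -> C) : Prop :=
  is_connected I /\ continuous_on I gamma /\ forall t, I t -> U (gamma t).

Definition path_connected (U : C -> Prop) : Prop :=
  forall z w, U z -> U w ->
  exists gamma, curve_in U unit_interval gamma /\ gamma 0 = z /\ gamma 1 = w.

Definition simply_connected (U : C -> Prop) : Prop :=
  path_connected U /\
  forall gamma, curve_in U unit_interval gamma -> gamma 0 = gamma 1 ->
  exists H : R * R -> C,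
    continuous_on unit_square H /\
    (forall p, unit_square p -> U (H p)) /\
    (forall t, unit_interval t -> H (t, 0) = gamma t /\ H (t, 1) = gamma 0) /\
    (forall s, unit_interval s -> H (0, s) = gamma 0 /\ H (1, s) = gamma 0).

(* The inverse hyperbolic tangent of the pseudo-hyperbolic distance. The other
   usual normalization, twice this one, has the same geodesics. *)
Definition poincare_dist (z w : C) : R :=
  let m := Cmod ((z - w) / (1 - Cconj w * z))%C in
  / 2 * ln ((1 + m) / (1 - m)).

Definition kobayashi_dist (Finv : C -> C) (z w : C) : R :=
  poincare_dist (Finv z) (Finv w).

(* Supremum over all partitions s = p 0 <= ... <= p (n + 1) = t; it may be
   infinite. *)
Definition curve_length (d : C -> C -> R) (gamma : R -> C) (s t : R) : Rbar :=
  Lub_Rbar (fun L => exists (n : nat) (p : nat -> R),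
    p 0%nat = s /\ p (S n) = t /\
    (forall i, (i <= n)%nat -> p i <= p (S i)) /\
    L = sum_n (fun i => d (gamma (p i)) (gamma (p (S i)))) n).

Definition geodesic (U : C -> Prop) (d : C -> C -> R) (I : R -> Prop)
    (gamma : R -> C) : Prop :=
  curve_in U I gamma /\
  forall s t, I s -> I t -> s <= t ->
  forall sigma, curve_in U unit_interval sigma ->
    sigma 0 = gamma s -> sigma 1 = gamma t ->
    Rbar_le (curve_length d gamma s t) (curve_length d sigma 0 1).

Definition whole_line (t : R) : Prop := True.

Definition disc_geodesic_line (gamma : R -> C) : Prop :=
  geodesic unit_disc poincare_dist whole_line gamma /\
  (exists xi : C, Cmod xi = 1 /\
     filterlim gamma (Rbar_locally p_infty) (locally xi)) /\
  (exists eta : C, Cmod eta = 1 /\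
     filterlim gamma (Rbar_locally m_infty) (locally eta)).

Definition image_geodesic_line (F : C -> C) (gamma : R -> C) : Prop :=
  exists delta, disc_geodesic_line delta /\ forall t, gamma t = F (delta t).

(* Geodesics are identified with their images, so a family of geodesics is a
   collection of subsets of C. *)
Definition geodesics_through (line : (R -> C) -> Prop) (a : C)
    (S : C -> Prop) : Prop :=
  (exists gamma, line gamma /\ forall z, S z <-> exists t, gamma t = z) /\
  closure S a.

Definition GP (U1 U2 : C -> Prop) (Fam1 Fam2 : (C -> Prop) -> Prop)
    (f : C -> C) : Prop :=
  maps_into U1 U2 f /\ holomorphic_on U1 f /\
  forall S1, Fam1 S1 -> exists S2, Fam2 S2 /\ maps_into S1 S2 f.

Lemma holomorphic_continuous (U : C -> Prop) (f : C -> C) (z : C) :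
  holomorphic_on U f -> U z -> filterlim f (locally z) (locally (f z)).
Proof.
intros Hf Uz P HP.
apply locally_C.
assert (H := ex_derive_continuous (K := C_AbsRing) (V := C_NormedModule)
               f z (Hf z Uz)).
exact (H P HP).
Qed.

Lemma curve_in_comp (U V : C -> Prop) (I : R -> Prop) (f : C -> C)
    (gamma : R -> C) :
  holomorphic_on U f -> maps_into U V f -> curve_in U I gamma ->
  curve_in V I (fun t => f (gamma t)).
Proof.
intros Hf HUV [HI [Hc Hin]]; split; [exact HI | split].
- intros t It.
  apply (filterlim_comp _ _ _ gamma f _ (locally (gamma t))).
  + exact (Hc t It).
  + exact (holomorphic_continuous U f (gamma t) Hf (Hin t It)).
- intros t It; exact (HUV _ (Hin t It)).
Qed.

Lemma image_geodesic_line_geodesic (U : C -> Prop) (F Finv : C -> C)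
    (gamma : R -> C) :
  biholomorphism unit_disc U F Finv -> image_geodesic_line F gamma ->
  geodesic U (kobayashi_dist Finv) whole_line gamma.
Proof.
intros (HF & HG & HGF & HFG & hF & hG) (delta & ((Hc & Hmin) & _) & Hgd).
assert (HFd : curve_in U whole_line (fun t => F (delta t)))
  by exact (curve_in_comp unit_disc U whole_line F delta hF HF Hc).
assert (Hd : forall t, Finv (gamma t) = delta t).
{ intros t; rewrite Hgd; apply HGF; apply Hc; exact Logic.I. }
split.
- destruct HFd as (H1 & H2 & H3); split; [exact H1 | split].
  + intros t It; rewrite Hgd.
    apply (filterlim_ext (fun t => F (delta t))); [easy | exact (H2 t It)].
  + intros t It; rewrite Hgd; exact (H3 t It).
- intros s t Is It st sigma Hs H0 H1.
  assert (Hle := Hmin s t Is It st (fun u => Finv (sigma u))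
    (curve_in_comp U unit_disc unit_interval Finv sigma hG HG Hs)).
  cbv beta in Hle; rewrite H0, H1, !Hd in Hle.
  specialize (Hle eq_refl eq_refl).
  replace (curve_length (kobayashi_dist Finv) gamma s t)
    with (curve_length poincare_dist delta s t); [exact Hle |].
  apply Lub_Rbar_eqset; intros L.
  split; intros (n & p & Hp0 & Hpn & Hp & HL); exists n, p;
    (split; [exact Hp0 | split; [exact Hpn | split; [exact Hp |]]]);
    rewrite HL; apply sum_n_ext; intros i; unfold kobayashi_dist;
    now rewrite !Hd.
Qed.

(* Main.v *)
Require Import Defs.

(** Conjugation by [F] is a bijection between holomorphic self-maps of the disc
    and those of [Omega]; it preserves geodesics because the geodesic lines of
    [Omega] are by definition the [F]-images of those of the disc. The base
    point matters only through the closures of the lines, and since [a] is an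
    interior point of the domain, mere continuity of [F] at [Finv a] and of
    [Finv] at [a] carries the condition on closures in both directions
    ([geodesics_through_image] and [geodesics_through_preimage]). Both
    implications of the theorem then have the same form: transport a line
    through one base point to the other domain, apply the given map there, and
    transport the resulting line back. *)

(** The chain rule for [ex_derive] asks the inner function to be
    differentiable for the normed structure that [C] has as an absolute ring,
    while [holomorphic_on] uses that of the product of two real lines. The two
    structures have the same operations and the same norm [Cmod], and a
    differential depends on nothing else in its target. *)
Lemma ex_derive_C_AbsRing (f : C -> C) (z : C) :
  ex_derive (K := C_AbsRing) (V := C_NormedModule) f z ->
  ex_derive (K := C_AbsRing) (V := AbsRing_NormedModule C_AbsRing) f z.
Proof.
intros [l [[Hplus Hscal Hnorm] Hdomin]].
exists l; split; [split; [exact Hplus | exact Hscal | exact Hnorm] |].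
exact Hdomin.
Qed.

Lemma holomorphic_on_comp (U V : C -> Prop) (f g : C -> C) :
  holomorphic_on U f -> maps_into U V f -> holomorphic_on V g ->
  holomorphic_on U (fun z => g (f z)).
Proof.
intros Hf HUV Hg z Uz.
apply (ex_derive_comp (K := C_AbsRing) (V := C_NormedModule) g f).
- exact (Hg _ (HUV z Uz)).
- exact (ex_derive_C_AbsRing f z (Hf z Uz)).
Qed.

(** Openness is essential: differentiability at a point of [U] involves the
    values near that point, so [U] has to contain them. *)
Lemma holomorphic_on_ext (U : C -> Prop) (f g : C -> C) :
  open U -> (forall z, U z -> f z = g z) ->
  holomorphic_on U f -> holomorphic_on U g.
Proof.
intros HU Hfg Hf z Uz.
apply (ex_derive_ext_loc (K := C_AbsRing) (V := C_NormedModule) f g);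
  [| exact (Hf z Uz)].
apply locally_C.
apply (filter_imp U); [exact Hfg | exact (HU z Uz)].
Qed.

Lemma closure_image (S T : C -> Prop) (f : C -> C) (a : C) :
  filterlim f (locally a) (locally (f a)) -> maps_into S T f ->
  closure S a -> closure T (f a).
Proof.
intros Hf HST Ha P HP.
destruct (Ha _ (Hf P HP)) as (w & HPw & Sw).
exists (f w); split; [exact HPw | exact (HST w Sw)].
Qed.

Lemma geodesics_through_image (U : C -> Prop) (F Finv : C -> C) (a : C)
    (S : C -> Prop) :
  biholomorphism unit_disc U F Finv -> U a ->
  geodesics_through disc_geodesic_line (Finv a) S ->
  geodesics_through (image_geodesic_line F) a
    (fun w => exists z, S z /\ F z = w).
Proof.
intros (HF & HG & HGF & HFG & hF & hG) Ua ((delta & Hdelta & HS) & Hcl).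
split.
- exists (fun t => F (delta t)); split; [now exists delta |].
  intros w; split.
  + intros (z & Sz & <-); destruct (proj1 (HS z) Sz) as [t <-]; now exists t.
  + intros [t <-]; exists (delta t); split; [apply HS; now exists t | easy].
- rewrite <- (HFG a Ua).
  apply (closure_image S); [| intros z Sz; now exists z | exact Hcl].
  exact (holomorphic_continuous unit_disc F _ hF (HG a Ua)).
Qed.

Lemma geodesics_through_preimage (U : C -> Prop) (F Finv : C -> C) (a : C)
    (S : C -> Prop) :
  biholomorphism unit_disc U F Finv -> U a ->
  geodesics_through (image_geodesic_line F) a S ->
  geodesics_through disc_geodesic_line (Finv a)
    (fun z => exists w, S w /\ Finv w = z).
Proof.
intros (HF & HG & HGF & HFG & hF & hG) Ua
  ((gamma & (delta & Hdelta & Hgd) & HS) & Hcl).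
assert (Hd : forall t, Finv (gamma t) = delta t).
{ intros t; rewrite Hgd; apply HGF.
  destruct Hdelta as ((Hc & _) & _); apply Hc; exact Logic.I. }
split.
- exists delta; split; [exact Hdelta |].
  intros z; split.
  + intros (w & Sw & <-); destruct (proj1 (HS w) Sw) as [t <-].
    exists t; now rewrite Hd.
  + intros [t <-]; exists (gamma t); split; [apply HS; now exists t | easy].
- apply (closure_image S); [| intros w Sw; now exists w | exact Hcl].
  exact (holomorphic_continuous U Finv a hG Ua).
Qed.

(** The formula [f z = F (g (Finv z))] says nothing outside [Omega], so it can
    be used along a line only once the line is known to stay in [Omega]. *)
Lemma geodesics_through_image_subset (U : C -> Prop) (F : C -> C) (a : C)
    (S : C -> Prop) :
  maps_into unit_disc U F ->
  geodesics_through (image_geodesic_line F) a S -> forall w, S w -> U w.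
Proof.
intros HF ((gamma & (delta & ((Hc & _) & _) & Hgd) & HS) & _) w Sw.
destruct (proj1 (HS w) Sw) as [t <-]; rewrite Hgd.
apply HF, Hc; exact Logic.I.
Qed.

Theorem theorem10 (Omega : C -> Prop) (F Finv : C -> C) (a : C)
  (Omega_open : open Omega) (Omega_sc : simply_connected Omega)
  (Omega_proper : exists z, ~ Omega z)
  (HF : biholomorphism unit_disc Omega F Finv) (Ha : Omega a) :
  forall f : C -> C,
    GP Omega Omega
      (geodesics_through (image_geodesic_line F) a)
      (geodesics_through (image_geodesic_line F) a) f
    <->
    exists g : C -> C,
      GP unit_disc unit_disc
        (geodesics_through disc_geodesic_line (Finv a))
        (geodesics_through disc_geodesic_line (Finv a)) g /\
      forall z, Omega z -> f z = F (g (Finv z)).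
Proof.
intros f.
assert (HF0 := HF).
destruct HF0 as (F_into & Finv_into & FinvK & FK & F_hol & Finv_hol).
split.
- intros (f_into & f_hol & f_geod).
  exists (fun z => Finv (f (F z))); split; [split; [| split] |].
  + intros z Dz; exact (Finv_into _ (f_into _ (F_into z Dz))).
  + apply (holomorphic_on_comp _ Omega (fun z => f (F z)) Finv);
      [| intros z Dz; exact (f_into _ (F_into z Dz)) | exact Finv_hol].
    exact (holomorphic_on_comp _ Omega F f F_hol F_into f_hol).
  + intros S1 HS1.
    destruct (f_geod _ (geodesics_through_image _ _ _ _ _ HF Ha HS1))
      as (S2 & HS2 & HS12).
    exists (fun z => exists w, S2 w /\ Finv w = z); split.
    * exact (geodesics_through_preimage _ _ _ _ _ HF Ha HS2).
    * intros z Sz; exists (f (F z)); split; [apply HS12; now exists z | easy].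
  + intros w Ow; rewrite (FK w Ow); symmetry; exact (FK _ (f_into w Ow)).
- intros (g & (g_into & g_hol & g_geod) & Hfg).
  split; [| split].
  + intros w Ow; rewrite (Hfg w Ow).
    exact (F_into _ (g_into _ (Finv_into w Ow))).
  + apply (holomorphic_on_ext Omega (fun w => F (g (Finv w))));
      [exact Omega_open | intros w Ow; symmetry; exact (Hfg w Ow) |].
    apply (holomorphic_on_comp _ unit_disc (fun w => g (Finv w)) F);
      [| intros w Ow; exact (g_into _ (Finv_into w Ow)) | exact F_hol].
    exact (holomorphic_on_comp _ unit_disc Finv g Finv_hol Finv_into g_hol).
  + intros S1 HS1.
    destruct (g_geod _ (geodesics_through_preimage _ _ _ _ _ HF Ha HS1))
      as (S2 & HS2 & HS12).
    exists (fun w => exists z, S2 z /\ F z = w); split.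
    * exact (geodesics_through_image _ _ _ _ _ HF Ha HS2).
    * intros w Sw.
      rewrite (Hfg w (geodesics_through_image_subset _ _ _ _ F_into HS1 w Sw)).
      exists (g (Finv w)); split; [apply HS12; now exists w | easy].
Qed.
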